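(* Let $k>0$ and let $Y_1,Y_2,\dots$ be i.i.d. qualities in $[0,1]$ whose gap $1-Y$ has cumulative distribution function $\Pr[1-Y\le x]=x^k$ for $x\in[0,1]$ (a power-law distribution). Fix $0\le \alpha<1$ and consider the threshold rule with $\mathcal{X}_0=[0,1]$ and $\mathcal{X}_i=\{y\in[0,1]: y\ge 1-c_i\}$ with $c_i=1/i^{\alpha}$ for $i\ge 1$. Then this threshold rule achieves an $O(1)$ approximation to the expected gap, i.e. there is a constant $C$ such that $E[\mathrm{Gap}_n]/E[\mathrm{Gap}^*_n]\le C$ for all $n$, where $C$ depends only on $\alpha$ and not on the parameter $k$ of the distribution.
   Context: Online selection: samples $Y_1,Y_2,\dots$ arrive one at a time; a threshold rule is a nested sequence of sets $\mathcal{X}_0\supseteq\mathcal{X}_1\supseteq\cdots$, and sample $Y_t$ is selected if and only if $Y_t\in\mathcal{X}_j$, where $j$ is the number of samples selected among $Y_1,\dots,Y_{t-1}$ (decisions are irrevocable). Let $T_n$ be the index of the $n$-th selected sample and $S_n$ the set of the $n$ selected samples. For a finite set $S$ of qualities, its mean quality gap is $\mathrm{Gap}(S)=1-\frac{1}{|S|}\sum_{y\in S}y$. Put $\mathrm{Gap}_n=\mathrm{Gap}(S_n)$ and $\mathrm{Gap}^*_n=\min\{\mathrm{Gap}(S): S\subseteq\{Y_1,\dots,Y_{T_n}\},|S|=n\}$ (the best $n$ among all samples seen up to the $n$-th selection). Expectations are over the random sample sequence. *)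

(* Defs.v *)
From HB Require Import structures.
From mathcomp Require Import all_boot all_order all_algebra.
From mathcomp Require Import all_classical all_reals all_analysis.
Set Implicit Arguments. Unset Strict Implicit. Unset Printing Implicit Defensive.
Import Order.TTheory GRing.Theory Num.Theory.
Local Open Scope classical_set_scope.
Local Open Scope ring_scope.

Section Selection.
Variable R : realType.
Variable alpha : R.

Definition in_thr (i : nat) (x : R) : bool :=
  (0 <= x <= 1) && ((i == 0)%N || (1 - (i%:R `^ alpha)^-1 <= x)).

(* y t is the quality of sample Y_{t+1} (0-based indexing). *)
Fixpoint cnt (y : nat -> R) (t : nat) : nat :=
  match t with
  | 0 => 0
  | t'.+1 => (cnt y t' + in_thr (cnt y t') (y t'))%N
  end.

Definition sel (y : nat -> R) (t : nat) : bool := in_thr (cnt y t) (y t).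

Definition gapS (y : nat -> R) (m : nat) (S : {set 'I_m}) : R :=
  1 - (#|S|%:R)^-1 * \sum_(i in S) y i.

Definition gap_sel (y : nat -> R) (m : nat) : R :=
  gapS y [set i : 'I_m | sel y i].

(* min of Gap(S) over all S among the first m samples with |S| = n;
   the default value of the big min is the Gap of the first n samples,
   which is itself one of the candidates when n <= m. *)
Definition gap_opt (y : nat -> R) (n m : nat) : R :=
  \big[Num.min/gapS y [set i : 'I_m | (i < n)%N]]_(S : {set 'I_m} | #|S| == n)
    gapS y S.

(* Gap_n : T_n = least m with cnt y m = n (number of samples seen at the
   n-th selection); 0 on the (null) event that fewer than n samples are
   ever selected. *)
Definition Gap (y : nat -> R) (n : nat) : R :=
  match pselect (exists m, cnt y m == n) with
  | left H => gap_sel y (ex_minn H)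
  | right _ => 0
  end.

Definition GapStar (y : nat -> R) (n : nat) : R :=
  match pselect (exists m, cnt y m == n) with
  | left H => gap_opt y n (ex_minn H)
  | right _ => 0
  end.
End Selection.

Definition mutually_independent d (T : measurableType d) (R : realType)
  (P : probability T R) (Y : nat -> T -> R) : Prop :=
  forall (s : seq nat), uniq s ->
  forall B : nat -> set R, (forall i, measurable (B i)) ->
    P (\bigcap_(i in [set` s]) (Y i @^-1` B i)) =
    (\prod_(i <- s) P (Y i @^-1` B i))%E.

(* Main.v *)
(* Write g_t for the gap of sample t, c_j for the gap threshold when j samples
   are held, N_t for the number held before sample t, and q_tj = P(N_t = j).
   Since N_t is independent of g_t and at most one sample is selected at each
   level j, sum_t q_tj * c_j^k <= 1.

   Upper bound: n * Gap_n is the sum over t of g_t on the event that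
   g_t <= c_(N_t) and N_t < n; by independence and the scaling of the power
   law, its mean is at most (1 - a) * sum_(j < n) c_j, where a = E[1 - g].

   Lower bound: for any tau and any n of the first T_n samples, the sum of the
   gaps is at least n * tau - sum_(t < T_n) (tau - g_t)^+. For tau = c_n the
   mean of the last sum is at most
   sum_(j < n) c_j^(-k) * tau^(k+1) * a <= n * tau * a (Wald's identity),
   so E[Gap*_n] >= c_n * (1 - a).

   The factor 1 - a, which carries the dependence on k, cancels, and what
   remains is sum_(j < n) c_j = O(n * c_n). Both bounds are obtained for the
   process stopped after N samples and with (tau - g)^+ replaced by a staircase
   with m steps, so that every mean is a finite sum of probabilities; then
   m = N tends to infinity. *)
Require Import Defs.
From HB Require Import structures.
From mathcomp Require Import all_boot all_order all_algebra.
From mathcomp Require Import all_classical all_reals all_analysis.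
From mathcomp Require Import ring lra zify.
Set Implicit Arguments. Unset Strict Implicit. Unset Printing Implicit Defensive.
Import Order.TTheory GRing.Theory Num.Theory.
Local Open Scope classical_set_scope.
Local Open Scope ring_scope.

(* [thr alpha j] is c_j, with c_0 = 1 encoding X_0 = [0, 1]. *)
Definition thr {R : realType} (alpha : R) (j : nat) : R :=
  if j == 0%N then 1 else (j%:R `^ alpha)^-1.

(** * Power sums of the thresholds *)

Section Thresholds.
Context {R : realType} {alpha : R}.
Hypothesis alpha0 : 0 <= alpha.

Lemma thr_gt0 j : 0 < thr alpha j.
Proof.
rewrite /thr; case: eqP => // /eqP; rewrite -lt0n => j0.
by rewrite invr_gt0 powR_gt0// ltr0n.
Qed.

Lemma thr_le i j : (i <= j)%N -> thr alpha j <= thr alpha i.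
Proof.
rewrite /thr; case: (posnP i) => [->|i0] ij.
  case: (posnP j) => [_|j0]; first exact: lexx.
  rewrite invf_le1 ?powR_gt0 ?ltr0n//.
  have := @ge0_ler_powR _ alpha alpha0 1 j%:R.
  by rewrite !nnegrE powR1; apply=> //; rewrite ler1n.
have j0 : (0 < j)%N by apply: leq_trans ij.
rewrite (gtn_eqF j0).
rewrite lef_pV2 ?posrE ?powR_gt0 ?ltr0n//.
by apply: ge0_ler_powR; rewrite ?nnegrE ?ler0n ?ler_nat.
Qed.

Lemma thr_le1 j : thr alpha j <= 1.
Proof. by apply: le_trans (thr_le (leq0n j)) _; rewrite /thr eqxx. Qed.

Lemma in_thrE i (x : R) : 0 <= x <= 1 -> in_thr alpha i x = (1 - x <= thr alpha i).
Proof.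
move=> x01; rewrite /in_thr x01 /thr /=; case: eqP => _ /=; last first.
  by rewrite lerBlDr lerBlDl addrC.
by rewrite gerBl; case/andP: x01.
Qed.

(** After division by (n+1)^b and with x = 1/(n+1), this is (1-x)^b <= 1 - b*x/2. The factor 2 is
    the price of an elementary proof through the exponential. *)
Lemma powR_diff_ge (b : R) (n : nat) : 0 < b <= 1 ->
  n.+1%:R `^ (b - 1) <= 2 / b * (n.+1%:R `^ b - n%:R `^ b).
Proof.
move=> /andP[b0 b1].
have n1 : 0 < n.+1%:R :> R by rewrite ltr0n.
set x : R := n.+1%:R^-1.
have x0 : 0 < x by rewrite invr_gt0.
have -> : n.+1%:R `^ (b - 1) = n.+1%:R `^ b * x.
  by rewrite powRD ?(gt_eqF n1) ?implybT// powR_inv1// ltW.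
suff H : n%:R `^ b <= n.+1%:R `^ b * (1 - b / 2 * x).
  have := powR_gt0 b n1; move: H; set u := _ `^ b; set v := _ `^ b => H v0.
  have -> : v * x = 2 / b * (v - v * (1 - b / 2 * x)).
    by field; rewrite gt_eqF.
  by rewrite ler_pM2l ?divr_gt0// lerD2l lerN2.
have x1 : x <= 1 by rewrite invf_le1// ler1n.
(* The case n = 0 is separate: there 1 - x = 0 and the argument by logarithms does not apply. *)
case: n @x x0 x1 n1 => [|n] x x0 x1 n1.
  rewrite powR0 ?gt_eqF// powR1 mul1r subr_ge0.
  by rewrite -[leRHS]mul1r ler_pM//; lra.
have -> : n.+1%:R = n.+2%:R * (1 - x) :> R.
  by rewrite mulrBr mulr1 mulfV ?gt_eqF// -[in RHS]natr1 addrK.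
have x1' : 0 < 1 - x by rewrite subr_gt0 invf_lt1 ?ltr1n.
rewrite powRM ?ler0n ?(ltW x1')// ler_wpM2l ?powR_ge0//.
rewrite /powR gt_eqF//.
have le_ln : b * ln (1 - x) <= - (b * x).
  by rewrite -mulrN ler_wpM2l ?(ltW b0)// le_ln1Dx// ltrN2; lra.
(* (1-x)^b <= exp(-b*x) <= 1/(1+b*x) <= 1 - b*x/2, the last because b*x <= 1. *)
apply: (@le_trans _ _ (1 + b * x)^-1).
  rewrite -[leLHS]invrK -expRN lef_pV2 ?posrE ?expR_gt0//; last by nra.
  by apply: le_trans (expR_ge1Dx _); rewrite lerD2l; lra.
have bx : 0 < b * x by rewrite mulr_gt0.
have bx1 : b * x <= 1 by rewrite -[leRHS]mul1r ler_pM// ltW.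
by rewrite -div1r ler_pdivrMr; nra.
Qed.

(** Telescoping [powR_diff_ge] with b = 1 - alpha compares the sum with n^(1-alpha) = n * c_n; the
    extra summand 1 accounts for c_0. *)
Lemma thr_sum (n : nat) : alpha < 1 -> (0 < n)%N ->
  \sum_(j < n) thr alpha j <= (1 + 2 / (1 - alpha)) * (n%:R * thr alpha n).
Proof.
move=> a1; case: n => // n _.
have b01 : 0 < 1 - alpha <= 1 by rewrite subr_gt0 a1 gerBl.
have n1 : 0 < n.+1%:R :> R by rewrite ltr0n.
have K0 : 0 <= 2 / (1 - alpha) by rewrite divr_ge0// subr_ge0 ltW.
have -> : n.+1%:R * thr alpha n.+1 = n.+1%:R `^ (1 - alpha).
  by rewrite /thr/= powRD ?(gt_eqF n1) ?implybT// powRr1 ?powRN ?(ltW n1).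
apply: (@le_trans _ _ (1 + 2 / (1 - alpha) * n%:R `^ (1 - alpha))).
  elim: n {n1} => [|n IH].
    by rewrite big_ord1 /thr/= lerDl mulr_ge0 ?powR_ge0.
  rewrite big_ord_recr/=; apply: le_trans (lerD IH (lexx _)) _.
  rewrite -addrA lerD2l -lerBrDl -mulrBr /thr/= -powRN.
  by have := powR_diff_ge n b01; rewrite addrAC subrr add0r.
have le1 : 1 <= n.+1%:R `^ (1 - alpha) :> R.
  have := @ge0_ler_powR _ (1 - alpha) _ 1 n.+1%:R.
  by rewrite !nnegrE powR1; apply; rewrite ?ler1n// subr_ge0 ltW.
rewrite [leRHS]mulrDl mul1r lerD// ler_wpM2l//.
by apply: ge0_ler_powR; rewrite ?nnegrE ?ler_nat// subr_ge0 ltW.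
Qed.

End Thresholds.

(* A step function approximating the positive part of [d * m - g] within [d];
   its mean under the power law is a finite sum. *)
Definition stair {R : realType} (m : nat) (d g : R) : R :=
  d * \sum_(i < m) (g <= d * i.+1%:R)%R%:R.

(** * Staircase approximation of the positive part *)

Section Staircase.
Context {R : realType}.
Implicit Types (d g c : R) (m : nat).

Lemma stair_ge0 m d g : 0 <= d -> 0 <= stair m d g.
Proof. by move=> d0; rewrite mulr_ge0 ?sumr_ge0. Qed.

Lemma stair_ge m d g : 0 <= d -> 0 <= g -> d * m%:R - g <= stair m d g.
Proof.
rewrite /stair => d0 g0; elim: m => [|m IH]; first by rewrite big_ord0; lra.
rewrite big_ord_recr/= mulrDr; move: IH.
have := @stair_ge0 m d g d0; rewrite /stair.
set s := d * _; rewrite -natr1; set n := m%:R.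
by rewrite mulrDr mulr1; case: (lerP g) => /= *; rewrite ?mulr1 ?mulr0; lra.
Qed.

Lemma stair_le m d g : 0 <= d ->
  stair m d g <= Num.max 0 (d * m%:R - g + d).
Proof.
rewrite /stair => d0; elim: m => [|m IH].
  by rewrite big_ord0 mulr0 le_max lexx.
rewrite big_ord_recr/= mulrDr; move: IH.
set s := d * _; rewrite -natr1; set n := m%:R.
rewrite !le_max mulrDr; case: (lerP g) => /= ? /orP[] ?; apply/orP;
  rewrite ?mulr1 ?mulr0; by [right; lra|left; lra].
Qed.

(** For g <= c, write g = c - (c - g); the staircase of step c/m exceeds c - g by at most c/m. For g
    > c every step vanishes. *)
Lemma clip_le_stair m c g : 0 < c -> 0 <= g -> (0 < m)%N ->
  (g <= c)%R%:R * g <=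
  c * (1 + m%:R^-1) * (g <= c)%R%:R - stair m (c / m%:R) g.
Proof.
move=> c0 g0 m0; have m0' : 0 < m%:R :> R by rewrite ltr0n.
have d0 : 0 <= c / m%:R by rewrite divr_ge0// ltW.
have := stair_le m g d0; rewrite divfK ?gt_eqF//.
case: (lerP g c) => gc /=; rewrite ?mulr1 ?mulr0 ?mul1r ?mul0r.
  by rewrite le_max => /orP[] ?; rewrite mulrDr mulr1; lra.
have -> : stair m (c / m%:R) g = 0; last by rewrite subrr.
rewrite /stair big1 ?mulr0// => i _; case: lerP => // gi.
have : c / m%:R * i.+1%:R <= c.
  by rewrite -[leRHS](@divfK _ m%:R) ?gt_eqF// ler_wpM2l// ler_nat.
by move=> /(le_trans gi); rewrite leNgt gc.
Qed.

End Staircase.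

(** * Pathwise bounds on the two gaps *)

Section Paths.
Context {R : realType} (alpha : R).
Hypothesis alpha0 : 0 <= alpha.
Variable y : nat -> R.
Hypothesis y01 : forall t, 0 <= y t <= 1.


Lemma gap_ge0 t : 0 <= 1 - y t. Proof. by case/andP: (y01 t); lra. Qed.

Lemma gap_le1 t : 1 - y t <= 1. Proof. by case/andP: (y01 t); lra. Qed.

Lemma cnt_sum m : cnt alpha y m = (\sum_(t < m) sel alpha y t)%N.
Proof. by elim: m => [|m IH]; rewrite ?big_ord0// big_ord_recr/= -IH. Qed.

Lemma cnt_le m m' : (m <= m')%N -> (cnt alpha y m <= cnt alpha y m')%N.
Proof.
move=> /subnKC <-; elim: (m' - m)%N => [|p IH]; first by rewrite addn0.
by rewrite addnS/=; apply: leq_trans IH (leq_addr _ _).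
Qed.

Lemma cnt_leq_id m : (cnt alpha y m <= m)%N.
Proof. by elim: m => //= m IH; case: (in_thr _ _ _); lia. Qed.

Lemma card_sel m : #|[set i : 'I_m | sel alpha y i]%SET| = cnt alpha y m.
Proof.
rewrite cnt_sum -sum1_card big_mkcond/=; apply: eq_bigr => i _.
by rewrite inE; case: sel.
Qed.

Lemma cnt_reached n N : (n <= cnt alpha y N)%N ->
  exists2 m, (m <= N)%N & cnt alpha y m == n.
Proof.
elim: N => [|N IH] /=; first by rewrite leqn0 => /eqP->; exists 0%N.
case: (leqP n (cnt alpha y N)) => [/IH[m mN mn] _|nN nN1].
  by exists m => //; exact: leqW.
by exists N.+1 => //=; move: nN nN1; case: (in_thr _ _ _); lia.
Qed.

Lemma gapS_sum m n (S : {set 'I_m}) : #|S| = n -> (0 < n)%N ->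
  n%:R * gapS y S = \sum_(i in S) (1 - y i).
Proof.
move=> Sn n0; rewrite /gapS Sn sumrB sumr_const Sn mulrBr mulr1 mulrA mulfV ?mul1r//.
by rewrite pnatr_eq0 -lt0n.
Qed.

Lemma gapS_ge0 m n (S : {set 'I_m}) : #|S| = n -> (0 < n)%N -> 0 <= gapS y S.
Proof.
move=> Sn n0; rewrite -(@pmulr_rge0 _ n%:R) ?ltr0n// (gapS_sum Sn)//.
by apply: sumr_ge0 => i _; exact: gap_ge0.
Qed.

Lemma gapS_le1 m n (S : {set 'I_m}) : #|S| = n -> (0 < n)%N -> gapS y S <= 1.
Proof.
move=> Sn n0; rewrite -(@ler_pM2l _ n%:R) ?ltr0n// (gapS_sum Sn)// mulr1.
apply: (@le_trans _ _ (\sum_(i in S) 1)); first by apply: ler_sum => i _; exact: gap_le1.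
by rewrite sumr_const Sn lexx.
Qed.

Lemma card_first n m : (n <= m)%N -> #|[set i : 'I_m | (i < n)%N]%SET| = n.
Proof.
move=> nm; rewrite -sum1_card big_mkcond/=.
under eq_bigr do rewrite inE.
by rewrite -big_mkcond/= -(big_ord_widen _ (fun=> 1%N))// sum1_card card_ord.
Qed.

(** The hypothesis n <= m makes the default value of the big minimum one of the candidates. *)
Lemma gap_opt_ge (x : R) n m : (n <= m)%N ->
  (forall S : {set 'I_m}, #|S| = n -> x <= gapS y S) -> x <= gap_opt y n m.
Proof.
move=> nm H; rewrite /gap_opt; elim/big_ind: _ => [|u v xu xv|S /eqP].
- exact/H/card_first.
- by rewrite le_min xu.
- exact: H.
Qed.

(** Trades the random level for a sum over fixed levels, to each of which independence applies. *)
Lemma sum_levels (F : nat -> R) n t :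
  \sum_(j < n) (cnt alpha y t == j)%:R * F j =
  (cnt alpha y t < n)%N%:R * F (cnt alpha y t).
Proof.
case: ltnP => h; last first.
  rewrite mul0r big1// => j _; rewrite gtn_eqF ?mul0r//.
  by apply: leq_trans (ltn_ord j) h.
rewrite (bigD1 (Ordinal h))//= eqxx big1 ?addr0// => j jh.
by rewrite [_ == _](_ : _ = false) ?mul0r//; apply: contraNF jh => /eqP jh; apply/eqP/val_inj.
Qed.

(** The first acceptable sample met at level j ends that level for good, so at most one term is
    1. *)
Lemma sum_sel_level j N :
  \sum_(t < N) ((cnt alpha y t == j) && (1 - y t <= thr alpha j)%R)%:R =
  (j < cnt alpha y N)%N%:R :> R.
Proof.
elim: N => [|N IH]; first by rewrite big_ord0.
rewrite big_ord_recr/= IH in_thrE//.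
case: (ltngtP j (cnt alpha y N)) => [jN|jN|<-] /=.
- by rewrite addr0; congr (_%:R); case: (_ <= _); lia.
- by rewrite addr0; congr (_%:R); case: (_ <= _); lia.
- by rewrite add0r; case: (_ <= _); rewrite ?addn1 ?ltnSn// addn0 ltnn.
Qed.

Lemma sum_ord_le (F : nat -> R) m N : (m <= N)%N -> (forall t, 0 <= F t) ->
  \sum_(t < m) F t <= \sum_(t < N) F t.
Proof.
move=> mN F0; rewrite (big_ord_widen _ F mN) [leLHS]big_mkcond/=.
by apply: ler_sum => i _; case: ifP.
Qed.

Lemma stopping_time n N (H : exists m, cnt alpha y m == n) :
  (n <= cnt alpha y N)%N ->
  [/\ cnt alpha y (ex_minn H) = n, (ex_minn H <= N)%N &
      forall t, (t < ex_minn H)%N -> (cnt alpha y t < n)%N].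
Proof.
case: ex_minnP => m /eqP mn min_m /cnt_reached[p pN pn]; split=> //.
  exact: leq_trans (min_m _ pn) pN.
move=> t tm; rewrite ltn_neqAle -{2}mn cnt_le ?(ltnW tm)// andbT.
by apply/negP => /min_m; rewrite leqNgt tm.
Qed.

Lemma Gap_le_sum n N : (0 < n)%N ->
  n%:R * Gap alpha y n <=
  \sum_(t < N) \sum_(j < n)
     (cnt alpha y t == j)%:R * ((1 - y t <= thr alpha j)%R%:R * (1 - y t))
  + n%:R * (cnt alpha y N < n)%N%:R.
Proof.
move=> n0.
under eq_bigr => t _ do
  rewrite (@sum_levels (fun j => (1 - y t <= thr alpha j)%R%:R * (1 - y t))).
set F := fun t => (cnt alpha y t < n)%N%:R *
   ((1 - y t <= thr alpha (cnt alpha y t))%R%:R * (1 - y t)).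
have F0 t : 0 <= F t by rewrite !mulr_ge0 ?gap_ge0.
rewrite /Gap; case: pselect => [H|_]; last first.
  by rewrite mulr0 addr_ge0 ?mulr_ge0// sumr_ge0// => t _; exact: F0.
(* If n selections are not complete after N samples, the trivial bound 1 on the gap is paid by the
   last term. *)
case: (ltnP (cnt alpha y N) n) => [_|/(stopping_time H)].
  apply: ler_wpDl; first by rewrite sumr_ge0// => t _; exact: F0.
  rewrite ler_wpM2l//; case: ex_minnP => m /eqP mn _.
  by rewrite (@gapS_le1 _ n) ?card_sel.
move: (ex_minn H) => m [mn mN m_lt].
rewrite mulr0 addr0 /gap_sel (@gapS_sum _ n) ?card_sel//.
apply: le_trans (sum_ord_le mN F0).
rewrite big_mkcond/=; apply: ler_sum => t _.
by rewrite inE /F m_lt// /sel in_thrE// mul1r; case: ifP => _; rewrite ?mul1r ?mul0r ?lexx.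
Qed.

(** [F] is any nonnegative majorant of tau - g_t, later a staircase. When n selections are not
    complete after N samples, the left side is at most 0. *)
Lemma GapStar_ge_sum (tau : R) (F : nat -> R) n N : (0 < n)%N -> 0 <= tau ->
  (forall t, 0 <= F t) -> (forall t, tau - (1 - y t) <= F t) ->
  n%:R * (tau * (1 - (cnt alpha y N < n)%N%:R))
  - \sum_(t < N) \sum_(j < n) (cnt alpha y t == j)%:R * F t <=
  n%:R * GapStar alpha y n.
Proof.
move=> n0 tau0 F0 tauF.
under eq_bigr => t _ do rewrite (@sum_levels (fun=> F t)).
set G := fun t => (cnt alpha y t < n)%N%:R * F t.
have G0 t : 0 <= G t by rewrite mulr_ge0.
rewrite /GapStar; case: pselect => [H|nH]; last first.
  case: ltnP => [_|/cnt_reached[m _ mn]]; last by exfalso; apply: nH; exists m.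
  by rewrite subrr !mulr0 sub0r oppr_le0 sumr_ge0// => t _; exact: G0.
case: ltnP => [_|/(stopping_time H)].
  rewrite subrr !mulr0 sub0r; apply: (@le_trans _ _ 0).
    by rewrite oppr_le0 sumr_ge0// => t _; exact: G0.
  rewrite mulr_ge0//; case: ex_minnP => m /eqP mn _; apply: gap_opt_ge => [|S Sn].
    by rewrite -mn cnt_leq_id.
  exact: gapS_ge0 Sn n0.
move: (ex_minn H) => m [mn mN m_lt].
rewrite subr0 mulr1 -ler_pdivrMl ?ltr0n//; apply: gap_opt_ge => [|S Sn].
  by rewrite -mn cnt_leq_id.
rewrite ler_pdivrMl ?ltr0n// (gapS_sum Sn)// lerBlDl.
(* Each of the n members of [S] contributes at least tau; the sum of [F] over [S] is then enlarged
   to all samples seen. *)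
apply: (@le_trans _ _ (\sum_(t in S) ((1 - y t) + F t))).
  rewrite mulrC mulr_natr -Sn -sumr_const; apply: ler_sum => t _.
  by rewrite -lerBlDl.
rewrite big_split/= addrC lerD2r.
apply: le_trans (sum_ord_le mN G0).
rewrite big_mkcond/=; apply: ler_sum => t _.
by rewrite /G m_lt// mul1r; case: ifP.
Qed.

End Paths.

(** * Calculus of finite means *)

Section Means.
Context {R : realType} d {T : measurableType d} (P : probability T R).
Implicit Types (f g : T -> R) (b : T -> bool) (u v : R).

(** Bundling integrability with a real value lets linear combinations be integrated without separate
    side conditions. *)
Definition has_mean f v : Prop :=
  P.-integrable setT (EFin \o f) /\ (\int[P]_w (f w)%:E = v%:E)%E.

Lemma has_mean_bool b : measurable [set w | b w] ->
  has_mean (fun w => (b w)%:R) (fine (P [set w | b w])).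
Proof.
move=> mb; have bE w : (b w)%:R = \1_[set w | b w] w :> R.
  by rewrite indicE; congr (_%:R); congr nat_of_bool; apply/idP/idP; rewrite inE.
rewrite /has_mean; under eq_integral do rewrite bE.
split; last by rewrite integral_indic// setIT fineK// fin_num_measure.
apply: eq_integrable (integrable_indic P mb) => // w _.
by rewrite /= bE.
Qed.

Lemma has_mean_eq f g v : f =1 g -> has_mean f v -> has_mean g v.
Proof. by move=> /funext ->. Qed.

Lemma has_meanZ f v u : has_mean f v -> has_mean (fun w => u * f w) (u * v).
Proof.
move=> [fi fv]; split; first exact: (integrableZl _ u fi).
under eq_integral do rewrite EFinM.
by rewrite integralZl// fv EFinM.
Qed.

Lemma has_meanD f g u v : has_mean f u -> has_mean g v ->
  has_mean (fun w => f w + g w) (u + v).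
Proof.
move=> [fi fv] [gi gv]; split; first exact: (integrableD _ fi gi).
under eq_integral do rewrite EFinD.
by rewrite integralD// fv gv EFinD.
Qed.

Lemma has_meanN f v : has_mean f v -> has_mean (fun w => - f w) (- v).
Proof.
by move=> /(has_meanZ (-1)); rewrite mulN1r; apply: has_mean_eq => w; rewrite mulN1r.
Qed.

Lemma has_mean_sum n (F : nat -> T -> R) (v : nat -> R) :
  (forall i, (i < n)%N -> has_mean (F i) (v i)) ->
  has_mean (fun w => \sum_(i < n) F i w) (\sum_(i < n) v i).
Proof.
elim: n => [_|n IH Fv].
  rewrite big_ord0; split; last first.
    by under eq_integral do rewrite big_ord0; rewrite integral0.
  apply: eq_integrable (integrable0 P setT) => // w _ /=.
  by rewrite big_ord0.
rewrite big_ord_recr/=.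
apply: has_mean_eq (has_meanD (IH (fun i h => Fv i (ltnW h))) (Fv n (ltnSn n))) => w.
by rewrite big_ord_recr.
Qed.

Lemma has_mean_cst v : has_mean (fun=> v) v.
Proof.
have -> : (fun=> v) = (fun w : T => v * (true)%:R) by apply/funext => w; rewrite mulr1.
rewrite -[X in has_mean _ X]mulr1; apply: has_meanZ.
have h : [set w : T | (fun=> true) w] = setT by apply/seteqP; split.
by have := @has_mean_bool (fun=> true); rewrite h probability_setT; apply.
Qed.

(* Holds without measurability because the integral is defined as a supremum
   over the simple functions below the integrand. *)
Lemma le_integral_nomeas (f g : T -> \bar R) : (forall w, f w <= g w)%E ->
  (\int[P]_w f w <= \int[P]_w g w)%E.
Proof.
move=> fg; rewrite /integral !patch_setT.
apply: leeB; apply: ereal_sup_le => _ [h hf <-]; exists h => //= w;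
  apply: le_trans (hf w) _.
  by apply: (@funepos_le _ _ setT); rewrite ?inE.
by apply: (@funeneg_le _ _ setT); rewrite ?inE.
Qed.

Lemma has_mean_le f g u v : has_mean f u -> has_mean g v ->
  (forall w, f w <= g w) -> u <= v.
Proof.
move=> [_ fu] [_ gv] fg; rewrite -lee_fin -fu -gv.
by apply: le_integral_nomeas => w; rewrite lee_fin.
Qed.

End Means.

(** * Independence of the current level from later samples *)

Section Process.
Context {R : realType} (alpha : R) d {T : measurableType d} (P : probability T R).
Variables (Y : nat -> T -> R) (k : R).
Hypothesis alpha0 : 0 <= alpha.
Hypothesis k0 : 0 < k.
Hypothesis mY : forall i, measurable_fun setT (Y i).
Hypothesis indepY : mutually_independent P Y.
Hypothesis Y01 : forall i w, 0 <= Y i w <= 1.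
Hypothesis lawY : forall i (x : R), 0 <= x <= 1 ->
  P [set w | 1 - Y i w <= x] = (x `^ k)%:E.

Local Notation N_ t w := (cnt alpha (fun i => Y i w) t).
Local Notation level t j := [set w | N_ t w == j].
Local Notation box s B := (\bigcap_(i in [set` s]) (Y i @^-1` B i)).
Local Notation accept j := [set x : R | in_thr alpha j x].

Lemma measurable_accept j : measurable (accept j).
Proof.
have -> : accept j =
    `[0, 1]%classic `&` (if j == 0%N then setT else `[1 - (j%:R `^ alpha)^-1, +oo[%classic).
  apply/seteqP; split => x; rewrite /in_thr /=; case: (j == 0%N);
    rewrite ?andbT /= ?in_itv/= ?andbT.
  - by move=> h; split.
  - by case/andP.
  - by case.
  - by case=> -> ->.
by apply: measurableI => //; case: ifP.
Qed.

Lemma measurable_preimage i (B : set R) : measurable B -> measurable (Y i @^-1` B).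
Proof. by move=> mB; rewrite -[X in measurable X]setTI; apply: mY. Qed.

(* The part of [level t.+1 j] on which sample [t] is selected. *)
Definition rise t j : set T :=
  if j is j'.+1 then level t j' `&` Y t @^-1` accept j' else set0.

Lemma level_succ t j :
  level t.+1 j = (level t j `&` Y t @^-1` ~` accept j) `|` rise t j.
Proof.
apply/seteqP; split => w /=.
  case h : (in_thr _ _ _) => /=; last first.
    by rewrite addn0 => /eqP <-; left; split => //; rewrite h.
  by rewrite addn1 => /eqP <- /=; right; split.
case=> [[/eqP <- /negP/negbTE ->]|]; first by rewrite addn0.
by case: j => //= j [/eqP <- ->]; rewrite addn1.
Qed.

Lemma measurable_level t j : measurable (level t j).
Proof.
elim: t j => [|t IH] j.
  case: j => [|j] /=.
    by rewrite (_ : [set _ | _] = setT)//; apply/seteqP; split.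
  by rewrite (_ : [set _ | _] = set0)//; apply/seteqP; split.
rewrite level_succ; apply: measurableU.
  apply: measurableI => //; apply: measurable_preimage; apply: measurableC.
  exact: measurable_accept.
case: j => //= j; apply: measurableI => //.
by apply: measurable_preimage; exact: measurable_accept.
Qed.

Lemma measurable_box (s : seq nat) (B : nat -> set R) :
  (forall i, measurable (B i)) -> measurable (box s B).
Proof.
move=> mB; apply: bigcap_measurableType => // i _.
exact: measurable_preimage.
Qed.

(* The event [level t j] is a finite disjoint union of boxes over the first
   [t] samples; carrying a box over later samples makes the induction close. *)
Lemma level_indep t j (s : seq nat) (B : nat -> set R) : uniq s ->
  (forall i, i \in s -> (t <= i)%N) -> (forall i, measurable (B i)) ->
  P (level t j `&` box s B) =
  (P (level t j) * \prod_(i <- s) P (Y i @^-1` B i))%E.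
Proof.
elim: t j s B => [|t IH] j s B us ts mB.
  case: j => [|j] /=.
    rewrite (_ : [set _ | _] = setT); last by apply/seteqP; split.
    by rewrite setTI probability_setT mul1e indepY.
  rewrite (_ : [set _ | _] = set0); last by apply/seteqP; split.
  by rewrite set0I measure0 mul0e.
(* A condition on sample t is one more side of the box, so the induction hypothesis applies to t ::
   s'. *)
have extend i (C : set R) (s' : seq nat) (B' : nat -> set R) :
    uniq s' -> (forall l, l \in s' -> (t < l)%N) ->
    (forall l, measurable (B' l)) -> measurable C ->
    P ((level t i `&` Y t @^-1` C) `&` box s' B') =
    (P (level t i) * P (Y t @^-1` C) * \prod_(l <- s') P (Y l @^-1` B' l))%E.
  move=> us' ts' mB' mC.
  have ts'' : t \notin s' by apply/negP => /ts'; rewrite ltnn.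
  pose B2 l := if l == t then C else B' l.
  rewrite (_ : _ `&` _ = level t i `&` box (t :: s') B2); last first.
    apply/seteqP; split => w.
      case=> -[wi wC] wB; split=> // l /=; rewrite /B2 inE.
      by case: eqVneq => [->|_] //= ls; exact: wB.
    case=> wi wB; split; first split=> //.
      by have := wB t; rewrite /B2 eqxx; apply; rewrite /= inE eqxx.
    move=> l /= ls; have := wB l; rewrite /B2 /= inE ls orbT => /(_ isT).
    by case: eqVneq => // lt; move: ls; rewrite lt (negbTE ts'').
  rewrite IH/= ?us' ?ts''//; last 2 first.
  - by move=> l; rewrite inE => /predU1P[->//|/ts'/ltnW].
  - by move=> l; rewrite /B2; case: ifP.
  rewrite big_cons {1}/B2 eqxx muleA; congr (_ * _)%E.
  rewrite big_seq [RHS]big_seq; apply: eq_bigr => l ls.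
  by rewrite /B2; case: eqVneq => // lt; move: ls; rewrite lt (negbTE ts'').
pose K := (P (level t j) * P (Y t @^-1` ~` accept j) +
  (if j is j'.+1 then P (level t j') * P (Y t @^-1` accept j') else 0))%E.
have key (s' : seq nat) (B' : nat -> set R) : uniq s' -> (forall l, l \in s' -> (t < l)%N) ->
    (forall l, measurable (B' l)) ->
    P (level t.+1 j `&` box s' B') = (K * \prod_(l <- s') P (Y l @^-1` B' l))%E.
  move=> us' ts' mB'.
  have mb := measurable_box s' mB'.
  have mc := measurableC (measurable_accept j).
  rewrite level_succ setIUl measureU; first last.
  (* The two pieces are disjoint, since they have different counts before sample t. *)
  - apply/seteqP; split => // w /= [[[/eqP wj _] _] [+ _]].
    rewrite /rise; case: (j) wj => // j' wj /= [/eqP wj' _].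
    by move: wj; rewrite wj' => /eqP; rewrite -[X in X == _]addn0 -addn1 eqn_add2l.
  - apply: measurableI => //; case: (j) => //= j'; apply: measurableI.
      exact: measurable_level.
    by apply: measurable_preimage; exact: measurable_accept.
  - apply: measurableI => //; apply: measurableI; first exact: measurable_level.
    exact: measurable_preimage.
  rewrite /K ge0_muleDl; last 2 first.
  - by rewrite mule_ge0.
  - by case: (j) => // j'; rewrite mule_ge0.
  congr (_ + _)%E; first exact: extend.
  rewrite /rise; case: (j) => [|j']; first by rewrite set0I measure0 mul0e.
  by apply: extend => //; exact: measurable_accept.
(* The empty box in [key] identifies [K] as the probability of the level. *)
rewrite key//; congr (_ * _)%E.
have := key [::] B isT (fun l => _) mB.
rewrite big_nil mule1 => <-//; congr (P _).
by rewrite set_nil bigcap_set0 setIT.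
Qed.

(** * Means of level indicators and staircases *)

Definition q t j : R := fine (P (level t j)).

Lemma q_ge0 t j : 0 <= q t j.
Proof. exact: fine_ge0. Qed.

Lemma has_mean_level t j : has_mean P (fun w => (N_ t w == j)%:R) (q t j).
Proof. exact: has_mean_bool (measurable_level t j). Qed.

(** The level before sample t is independent of that sample: [level_indep] with a box of one side,
    then the power law. *)
Lemma has_mean_level_le t j x : 0 <= x <= 1 ->
  has_mean P (fun w => ((N_ t w == j) && (1 - Y t w <= x)%R)%:R) (q t j * x `^ k).
Proof.
move=> x01.
have mx : measurable [set u : R | 1 - u <= x].
  rewrite (_ : [set _ | _] = `[1 - x, +oo[%classic)//.
  by apply/seteqP; split => u /=; rewrite in_itv/= andbT lerBlDr lerBlDl addrC.
have E : [set w | (N_ t w == j) && (1 - Y t w <= x)] =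
    level t j `&` box [:: t] (fun=> [set u : R | 1 - u <= x]).
  apply/seteqP; split => w /=.
    by case/andP=> -> wx; split=> // i /=; rewrite inE => /eqP ->.
  by case=> -> wB; apply: (wB t); rewrite /= inE.
have -> : q t j * x `^ k = fine (P [set w | (N_ t w == j) && (1 - Y t w <= x)]).
  rewrite E level_indep//; last by move=> i; rewrite inE => /eqP ->.
  rewrite big_seq1.
  have -> : P (Y t @^-1` [set u : R | 1 - u <= x]) = (x `^ k)%:E by exact: lawY.
  by rewrite fineM// fin_num_measure//; exact: measurable_level.
apply: has_mean_bool; rewrite E; apply: measurableI.
  exact: measurable_level.
exact: measurable_box.
Qed.


(* Riemann sum of [x `^ k] over [0, 1]; only its lying in [0, 1] matters. *)
Definition pmean m : R := m%:R^-1 * \sum_(i < m) (i.+1%:R / m%:R) `^ k.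

Lemma pmean_le1 m : pmean m <= 1.
Proof.
rewrite /pmean; case: m => [|m]; first by rewrite big_ord0 mulr0.
rewrite mulrC ler_pdivrMr ?ltr0n// mul1r.
apply: (@le_trans _ _ (\sum_(i < m.+1) 1)); last by rewrite sumr_const card_ord.
apply: ler_sum => i _; rewrite [leRHS](_ : _ = 1 `^ k); last by rewrite powR1.
by apply: ge0_ler_powR; rewrite ?nnegrE ?divr_ge0 ?(ltW k0)//
  ler_pdivrMr ?ltr0n// mul1r ler_nat.
Qed.

Lemma pmean_ge0 m : 0 <= pmean m.
Proof. by rewrite mulr_ge0 ?invr_ge0// sumr_ge0// => i _; exact: powR_ge0. Qed.

(** Scaling of the power law pulls c^k out of every step. The remaining factor [pmean m] is the same
    for all c, which allows it to cancel in the end. *)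
Lemma has_mean_stair t j m c : 0 < c <= 1 -> (0 < m)%N ->
  has_mean P (fun w => (N_ t w == j)%:R * stair m (c / m%:R) (1 - Y t w))
    (q t j * (c * c `^ k * pmean m)).
Proof.
move=> /andP[c0 c1] m0; have m0' : 0 < m%:R :> R by rewrite ltr0n.
have -> : q t j * (c * c `^ k * pmean m) = c / m%:R *
    \sum_(i < m) q t j * (c / m%:R * i.+1%:R) `^ k.
  have -> : \sum_(i < m) q t j * (c / m%:R * i.+1%:R) `^ k =
      q t j * c `^ k * \sum_(i < m) (i.+1%:R / m%:R) `^ k.
    rewrite mulr_sumr; apply: eq_bigr => i _.
    by rewrite -mulrA [_^-1 * _]mulrC powRM ?divr_ge0// ?(ltW c0)// mulrA.
  by rewrite /pmean; ring.
have H : has_mean P (fun w => \sum_(i < m)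
    ((N_ t w == j) && (1 - Y t w <= c / m%:R * i.+1%:R)%R)%:R)
    (\sum_(i < m) q t j * (c / m%:R * i.+1%:R) `^ k).
  apply: (@has_mean_sum _ _ _ P m
    (fun i w => ((N_ t w == j) && (1 - Y t w <= c / m%:R * i.+1%:R)%R)%:R)
    (fun i => q t j * (c / m%:R * i.+1%:R) `^ k)) => i im.
  apply: has_mean_level_le; rewrite mulr_ge0 ?divr_ge0 ?(ltW c0)//=.
  rewrite mulrAC ler_pdivrMr// mul1r -[leRHS]mul1r ler_pM ?ler_nat// ltW//.
apply: has_mean_eq (has_meanZ (c / m%:R) H) => w.
rewrite /stair mulrCA; congr (_ * _); rewrite mulr_sumr.
by apply: eq_bigr => i _; rewrite -mulnb natrM.
Qed.

(** * Time spent at a level and the tail of T_n *)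

(** The mean of [sum_sel_level]. *)
Lemma sum_q_le1 j N : \sum_(t < N) q t j * thr alpha j `^ k <= 1.
Proof.
have thr01 : 0 <= thr alpha j <= 1 by rewrite (ltW (thr_gt0 _)) thr_le1.
apply: (@has_mean_le _ _ _ P (fun w => \sum_(t < N)
    ((N_ t w == j) && (1 - Y t w <= thr alpha j)%R)%:R) (fun=> 1)).
- apply: (@has_mean_sum _ _ _ P N
    (fun t w => ((N_ t w == j) && (1 - Y t w <= thr alpha j)%R)%:R)
    (fun t => q t j * thr alpha j `^ k)) => t _.
  exact: has_mean_level_le.
- exact: has_mean_cst.
- by move=> w; rewrite sum_sel_level// lern1 leq_b1.
Qed.

(* [P (cnt y N < n)], the probability that [T_n > N]. *)
Definition pending n N : R := \sum_(j < n) q N j.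

Lemma has_mean_pending n N : has_mean P (fun w => (N_ N w < n)%N%:R) (pending n N).
Proof.
apply: has_mean_eq (has_mean_sum (fun j _ => has_mean_level N j)) => w.
have := sum_levels alpha (fun i => Y i w) (fun=> 1) n N.
by rewrite mulr1 => <-; apply: eq_bigr => j _; rewrite mulr1.
Qed.

Lemma pending_anti n N N' : (N <= N')%N -> pending n N' <= pending n N.
Proof.
move=> NN'; apply: has_mean_le (has_mean_pending _ _) (has_mean_pending _ _) _ => w.
rewrite ler_nat; have := cnt_le alpha (fun i => Y i w) NN'.
by case: ltnP => // h1 h2; rewrite (leq_ltn_trans h2 h1).
Qed.

(** As [pending] decreases in time, N times its value at N is at most its sum over t < N, which
    [sum_q_le1] bounds level by level. *)
Lemma pending_le n N : (0 < N)%N ->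
  pending n N <= (\sum_(j < n) (thr alpha j `^ k)^-1) / N%:R.
Proof.
move=> N0; rewrite ler_pdivlMr ?ltr0n//.
apply: (@le_trans _ _ (\sum_(t < N) pending n t)).
  rewrite mulr_natr -[X in _ *+ X](card_ord N) -sumr_const; apply: ler_sum => t _.
  exact/pending_anti/ltnW.
rewrite /pending exchange_big/=; apply: ler_sum => j _.
by rewrite -div1r ler_pdivlMr ?powR_gt0 ?thr_gt0// mulr_suml sum_q_le1.
Qed.

(** * Bounds on the two expected gaps and their comparison *)

Lemma mean_Gap_le n N m : (0 < n)%N -> (0 < m)%N ->
  (\int[P]_w (Gap alpha (fun i => Y i w) n)%:E <=
   (n%:R^-1 * (\sum_(j < n) thr alpha j * (1 + m%:R^-1 - pmean m)) + pending n N)%:E)%E.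
Proof.
move=> n0 m0; set D := 1 + m%:R^-1 - pmean m.
have D0 : 0 <= D.
  by rewrite /D addrAC addr_ge0 ?invr_ge0// subr_ge0 pmean_le1.
(* The majorant of [clip_le_stair] on level j; its mean is explicit. *)
pose f t j w : R := thr alpha j * (1 + m%:R^-1) *
    ((N_ t w == j) && (1 - Y t w <= thr alpha j)%R)%:R -
  (N_ t w == j)%:R * stair m (thr alpha j / m%:R) (1 - Y t w).
have mf t j : has_mean P (f t j) (thr alpha j * D * (q t j * thr alpha j `^ k)).
  have -> : thr alpha j * D * (q t j * thr alpha j `^ k) =
    thr alpha j * (1 + m%:R^-1) * (q t j * thr alpha j `^ k) -
    q t j * (thr alpha j * thr alpha j `^ k * pmean m) by rewrite /D; ring.
  apply: has_meanD; first apply: has_meanZ.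
    by apply: has_mean_level_le; rewrite (ltW (thr_gt0 _)) thr_le1.
  by apply: has_meanN; apply: has_mean_stair => //; rewrite thr_gt0 thr_le1.
have [_ mean_f] := has_meanZ n%:R^-1 (has_meanD
  (has_mean_sum (n := N) (fun t _ => has_mean_sum (n := n) (fun j _ => mf t j)))
  (has_meanZ n%:R (has_mean_pending n N))).
apply: (@le_trans _ _ (n%:R^-1 * (\sum_(t < N) \sum_(j < n)
    thr alpha j * D * (q t j * thr alpha j `^ k) + n%:R * pending n N))%:E).
  rewrite -mean_f; apply: le_integral_nomeas => w; rewrite lee_fin.
  rewrite ler_pdivlMl ?ltr0n//.
  apply: le_trans (Gap_le_sum alpha0 (fun i => Y01 i w) N n0) _.
  rewrite lerD2r; apply: ler_sum => t _; apply: ler_sum => j _.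
  rewrite /f -mulnb natrM.
  have g0 : 0 <= 1 - Y t w by rewrite subr_ge0; case/andP: (Y01 t w).
  have := clip_le_stair (thr_gt0 j) g0 m0.
  by case: (N_ t w == j); rewrite ?mul1r ?mul0r ?mulr0 ?subrr.
rewrite lee_fin mulrDr mulKf ?pnatr_eq0 -?lt0n// lerD2r.
rewrite ler_wpM2l ?invr_ge0// exchange_big/=; apply: ler_sum => j _.
rewrite -mulr_sumr -[leRHS]mulr1 ler_wpM2l ?sum_q_le1//.
by rewrite mulr_ge0// ltW// thr_gt0.
Qed.

Lemma mean_GapStar_ge n N m : (0 < n)%N -> (0 < m)%N ->
  ((thr alpha n * (1 - pending n N - pmean m))%:E <=
   \int[P]_w (GapStar alpha (fun i => Y i w) n)%:E)%E.
Proof.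
move=> n0 m0; set tau := thr alpha n.
have tau0 : 0 < tau := thr_gt0 n.
have d0 : 0 <= tau / m%:R by rewrite divr_ge0// ltW.
have mf t j := @has_mean_stair t j m tau (introT andP (conj tau0 (thr_le1 alpha0 n))) m0.
have [_ mean_f] := has_meanZ n%:R^-1 (has_meanD
  (has_meanZ n%:R (has_meanZ tau (has_meanD (has_mean_cst P 1)
    (has_meanN (has_mean_pending n N)))))
  (has_meanN (has_mean_sum (n := N) (fun t _ => has_mean_sum (n := n) (fun j _ => mf t j))))).
have le_GapStar w : ((n%:R^-1 * (n%:R * (tau * (1 - (N_ N w < n)%N%:R)) -
    \sum_(t < N) \sum_(j < n) (N_ t w == j)%:R * stair m (tau / m%:R) (1 - Y t w)))%:E
    <= (GapStar alpha (fun i => Y i w) n)%:E)%E.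
  rewrite lee_fin ler_pdivrMl ?ltr0n//.
  apply: (@GapStar_ge_sum _ alpha alpha0 _ (fun i => Y01 i w) tau
    (fun t => stair m (tau / m%:R) (1 - Y t w))) => //.
  - exact: ltW.
  - by move=> t; exact: stair_ge0.
  - move=> t; rewrite -[X in X - _](@divfK _ m%:R) ?pnatr_eq0 -?lt0n//.
    by apply: stair_ge => //; rewrite subr_ge0; case/andP: (Y01 t w).
apply: le_trans (le_integral_nomeas P le_GapStar).
rewrite mean_f lee_fin [leRHS]mulrBr mulKf ?pnatr_eq0 -?lt0n//.
rewrite [leLHS]mulrBr lerD2l lerN2 ler_pdivrMl ?ltr0n// exchange_big/=.
rewrite mulr_natl -[X in _ *+ X](card_ord n) -sumr_const.
apply: ler_sum => j _.
(* The choice tau = c_n <= c_j for j < n lets tau^k be replaced by c_j^k, so that [sum_q_le1]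
   applies. *)
apply: (@le_trans _ _ (\sum_(t < N) tau * pmean m * (q t j * thr alpha j `^ k))).
  apply: ler_sum => t _.
  have -> : q t j * (tau * tau `^ k * pmean m) = tau * pmean m * (q t j * tau `^ k) by ring.
  apply: ler_wpM2l; first by rewrite mulr_ge0 ?pmean_ge0// ltW.
  apply: ler_wpM2l; first exact: q_ge0.
  apply: ge0_ler_powR; rewrite ?nnegrE ?(ltW tau0) ?(ltW k0) ?(ltW (thr_gt0 _))//.
  by apply: (thr_le alpha0); exact: ltnW.
rewrite -mulr_sumr -[leRHS]mulr1 ler_wpM2l ?sum_q_le1//.
by rewrite mulr_ge0 ?pmean_ge0// ltW.
Qed.

Lemma mean_Gap_le_mean_GapStar n : alpha < 1 -> (0 < n)%N ->
  (\int[P]_w (Gap alpha (fun i => Y i w) n)%:E <=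
   (1 + 2 / (1 - alpha))%:E * \int[P]_w (GapStar alpha (fun i => Y i w) n)%:E)%E.
Proof.
move=> a1 n0; set C := 1 + _.
have C0 : 0 <= C by rewrite addr_ge0// divr_ge0// subr_ge0 ltW.
set tau := thr alpha n; have tau0 : 0 <= tau := ltW (thr_gt0 n).
set B := \sum_(j < n) (thr alpha j `^ k)^-1.
(* With m = N the total error is at most K / N: C * tau comes from the staircase, the rest from
   [pending], which is at most B / N. *)
pose K := C * tau + (C * tau + 1) * B.
apply/lee_addgt0Pr => e e0.
pose N := (Num.truncn (K / e)).+1.
have N0 : 0 < N%:R :> R by rewrite ltr0n.
have KN : K / N%:R <= e.
  by rewrite ler_pdivrMr// mulrC -ler_pdivrMr// ltW// truncnS_gt.
apply: le_trans (mean_Gap_le N n0 (ltn0Sn _ : (0 < N)%N)) _.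
have lower := mean_GapStar_ge N n0 (ltn0Sn _ : (0 < N)%N).
apply: le_trans (leeD (lee_wpmul2l _ lower) (lexx e%:E)); last by rewrite lee_fin.
rewrite -EFinM -EFinD lee_fin -/tau -mulr_suml mulrA.
have pN := pending_le n (ltn0Sn _ : (0 < N)%N); rewrite -/B in pN.
set a := pmean _; set p := pending _ _ in pN *; set D := 1 + _^-1 - a.
have D0 : 0 <= D.
  by rewrite /D addrAC addr_ge0 ?invr_ge0// subr_ge0 pmean_le1.
have SD : n%:R^-1 * (\sum_(j < n) thr alpha j) * D <= C * tau * D.
  rewrite ler_wpM2r// ler_pdivrMl ?ltr0n//.
  by have := thr_sum alpha0 a1 n0; rewrite -/C -/tau mulrCA.
apply: (@le_trans _ _ (C * (tau * (1 - p - a)) + K / N%:R)); last by rewrite lerD2l.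
apply: (@le_trans _ _ (C * tau * D + p)); first by rewrite lerD2r.
(* The terms in 1 - a agree on both sides; only errors of order 1/N remain. *)
have -> : C * tau * D + p = C * (tau * (1 - p - a)) + (C * tau / N%:R + (C * tau + 1) * p).
  by rewrite /D; ring.
rewrite lerD2l /K [leRHS]mulrDl lerD2l -[leRHS]mulrA.
by apply: ler_wpM2l => //; rewrite addr_ge0// mulr_ge0.
Qed.

End Process.

Theorem theorem1 (R : realType) (alpha : R) (halpha : 0 <= alpha < 1) :
  exists C : R,
  forall (k : R), 0 < k ->
  forall (d : measure_display) (T : measurableType d) (P : probability T R)
         (Y : nat -> T -> R),
    (forall i, measurable_fun setT (Y i)) ->
    mutually_independent P Y ->
    (forall i w, 0 <= Y i w <= 1) ->
    (forall i (x : R), 0 <= x <= 1 ->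
        P [set w | 1 - Y i w <= x] = (x `^ k)%:E) ->
    forall n : nat, (0 < n)%N ->
      (\int[P]_w (Gap alpha (fun i => Y i w) n)%:E <=
       C%:E * \int[P]_w (GapStar alpha (fun i => Y i w) n)%:E)%E.
Proof.
case/andP: halpha => alpha0 alpha1; exists (1 + 2 / (1 - alpha)).
move=> k k0 d T P Y mY indepY Y01 lawY n n0.
exact: (mean_Gap_le_mean_GapStar alpha0 k0).
Qed.
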